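(* Let $\mathcal C$ be an admissible class of graphons, and let $H$ be a finite graph with $2e(H)>v(H)$. If $H$ is $\mathcal C$-Sidorenko and $W\in\mathcal C$ satisfies $$t(H,W)=p(W)^{e(H)},$$ then $W$ is $p(W)$-regular.
   Context: All underlying probability spaces $(\Omega,\mu)$ are standard and atomless (so isomorphic to $[0,1]$ with Lebesgue measure). A graphon is a symmetric measurable function $W:\Omega^2\to[0,1]$ on such a space. Graphs are finite and simple, with at least one edge; isolated vertices are deleted, so $v(H)$ denotes the number of non-isolated vertices of $H$ and $e(H)$ the number of edges. The homomorphism density is $t(H,W)=\int_{\Omega^{V(H)}}\prod_{uv\in E(H)}W(x_u,x_v)\prod_{u\in V(H)}d\mu(x_u)$, and $p(W)=t(K_2,W)=\int_{\Omega^2}W\,d\mu\,d\mu$. The degree function is $\deg_W(x)=\int_\Omega W(x,y)\,d\mu(y)$; $W$ is $p$-regular (where $p=p(W)$) if $\deg_W=p$ almost everywhere. For $k\ge1$, the tensor power $W^{\otimes k}$ is the graphon on $(\Omega^k,\mu^k)$ given by $W^{\otimes k}(x,y)=\prod_{r=1}^kW(x_r,y_r)$. For measurable $S\subseteq\Omega$ with $\alpha=\mu(S)>0$, the normalized principal restriction $W[S]$ is the graphon on $(S,\mu|_S/\alpha)$ given by $W[S](x,y)=W(x,y)$ for $x,y\in S$. A class $\mathcal C$ of graphons (considered up to measure-preserving isomorphism of the underlying standard atomless probability spaces) is admissible if: (A1) $W\in\mathcal C$ implies $W^{\otimes k}\in\mathcal C$ for every $k\ge1$; (A2) $W\in\mathcal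 C$ and $S$ a positive-measure measurable subset of the underlying space of $W$ imply $W[S]\in\mathcal C$. $H$ is $\mathcal C$-Sidorenko if $t(H,W)\ge p(W)^{e(H)}$ for every $W\in\mathcal C$. *)

(* Defs.v *)
From HB Require Import structures.
From mathcomp Require Import all_boot all_order all_algebra.
From mathcomp Require Import all_classical all_reals all_analysis.

Set Implicit Arguments.
Unset Strict Implicit.
Unset Printing Implicit Defensive.

Import Order.TTheory GRing.Theory Num.Theory.
Import numFieldNormedType.Exports.

Local Open Scope classical_set_scope.
Local Open Scope ring_scope.

Section tuple_power.
Context d (T : measurableType d) (R : realType).

Definition tuple_cons n (z : T * n.-tuple T) : n.+1.-tuple T :=
  [tuple of z.1 :: z.2].

Lemma measurable_tuple_cons n : measurable_fun [set: T * n.-tuple T] (@tuple_cons n).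
Proof.
exact: (measurable_cons measurable_fst measurable_snd).
Qed.

HB.instance Definition _ n :=
  isMeasurableFun.Build _ _ _ _ (@tuple_cons n) (@measurable_tuple_cons n).

(* the product probability measure on T^n, with the product sigma-algebra
   of the library on n.-tuple T *)
Fixpoint tuple_power (mu : probability T R) n : probability (n.-tuple T) R :=
  if n is m.+1 then distribution (mu \x tuple_power mu m)%E (@tuple_cons m)
  else dirac [tuple].

End tuple_power.

Section restriction.
Context d (T : measurableType d) (R : realType) (mu : probability T R).
Context (S : set T) (mS : measurable S) (S_gt0 : (0 < mu S)%E).

Lemma mu_gt0_nonempty : S !=set0.
Proof. by apply/set0P/eqP => S0; move: S_gt0; rewrite S0 measure0 ltxx. Qed.

(* S as a type; positivity of mu S is used for the distinguished point that
   every measurableType carries *)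
Definition restr_type & (0 < mu S)%E : Type := set_type S.

HB.instance Definition _ := Choice.on (restr_type S_gt0).
HB.instance Definition _ := isPointed.Build (restr_type S_gt0)
  (exist _ (sval (cid mu_gt0_nonempty)) (mem_set (svalP (cid mu_gt0_nonempty)))).

Definition restr_val (x : restr_type S_gt0) : T := \val x.

(* S with the trace sigma-algebra *)
Definition restr_space := g_sigma_algebra_preimageType restr_val.

(* mu|_S / mu S *)
Definition restr_measure & measurable S : set restr_space -> \bar R :=
  fun A => (mu (restr_val @` A) * ((fine (mu S))^-1)%:E)%E.

Let image_preimage (B : set T) :
  restr_val @` (restr_val @^-1` B) = B `&` S.
Proof.
apply/seteqP; split => [_ [x Bx <-]|x [Bx Sx]].
  by split => //; exact: set_mem (valP x).
by exists (exist _ x (mem_set Sx)).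
Qed.

Let measurable_image (A : set restr_space) :
  measurable A -> measurable (restr_val @` A).
Proof.
move=> [B mB <-]; rewrite setTI image_preimage; exact: measurableI.
Qed.

Let restr_val_inj : injective restr_val.
Proof. exact: val_inj. Qed.

Local Notation nu := (restr_measure mS).

Let nu0 : nu set0 = 0%E.
Proof. by rewrite /restr_measure image_set0 measure0 mul0e. Qed.

Let fine_gt0 : 0 < fine (mu S).
Proof. by rewrite fine_gt0// S_gt0 ltey_eq fin_num_measure. Qed.

Let nu_ge0 A : (0 <= nu A)%E.
Proof. by rewrite /restr_measure mule_ge0// lee_fin invr_ge0 ltW. Qed.

Let nu_sigma_additive : semi_sigma_additive nu.
Proof.
move=> F mF tF mUF; rewrite /restr_measure.
rewrite [X in X @ _ --> _](_ : _ =
    (fun n => \sum_(0 <= i < n) mu (restr_val @` F i))%E \*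
    cst ((fine (mu S))^-1)%:E)%E; last first.
  by apply/funext => n /=; rewrite -ge0_sume_distrl.
apply: cvgeZr => //; rewrite image_bigcup.
apply: measure_semi_sigma_additive.
- by move=> i; exact: measurable_image.
- apply/trivIsetP => i j _ _ ij.
  apply/eqP/negPn/negP => /set0P[_ [[x Fix <-] [y Fjy /restr_val_inj yx]]].
  move/trivIsetP : tF => /(_ _ _ I I ij)/seteqP[+ _] => /(_ x); apply.
  by split => //; rewrite -yx.
- by rewrite -image_bigcup; exact: measurable_image.
Qed.

HB.instance Definition _ := isMeasure.Build _ _ _ nu nu0 nu_ge0
  nu_sigma_additive.

Let nuT : nu [set: restr_space] = 1%E.
Proof.
rewrite /restr_measure -(preimage_setT restr_val) image_preimage setTI.
rewrite -[in X in (X * _)%E](@fineK _ (mu S)) ?fin_num_measure//.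
by rewrite -EFinM divff// gt_eqF.
Qed.

HB.instance Definition _ := Measure_isProbability.Build _ _ _ nu nuT.

End restriction.

Arguments restr_val {d T R mu S} S_gt0 x.
Arguments restr_space {d T R mu S} S_gt0.
Arguments restr_measure {d T R mu S} S_gt0 mS.

(* raw data on a probability space; the graphons are the pregraphons satisfying
   is_graphon, and a class of graphons is a predicate C contained in it *)
Record pregraphon (R : realType) := Pregraphon {
  gdisp : measure_display;
  gspace : measurableType gdisp;
  gmu : probability gspace R;
  gfun : gspace * gspace -> R }.

Arguments gfun {R} p _.

Section probability_space.
Context d (T : measurableType d) (R : realType).

(* a standard Borel space: a Polish space with its Borel sigma-algebra *)
Definition standard_borel := exists (X : completePseudoMetricType R) (f : T -> X),
  [/\ hausdorff_space X, second_countable (T := X), bijective f &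
      @measurable _ T = [set f @^-1` B | B in <<s @open X >>]].

Definition atomless (mu : probability T R) := forall A : set T,
  measurable A -> (0 < mu A)%E ->
  exists B, [/\ measurable B, B `<=` A, (0 < mu B)%E & (mu B < mu A)%E].

End probability_space.

Definition is_graphon (R : realType) (W : pregraphon R) :=
  [/\ standard_borel (gspace W) R, atomless (gmu W),
      measurable_fun setT (gfun W),
      (forall x y, gfun W (x, y) = gfun W (y, x)) &
      (forall x y, 0 <= gfun W (x, y) <= 1)].

Definition edge_density (R : realType) (W : pregraphon R) : R :=
  \int[(gmu W \x gmu W)%E]_z gfun W z.

Definition degree (R : realType) (W : pregraphon R) (x : gspace W) : R :=
  \int[gmu W]_y gfun W (x, y).

Definition regular (R : realType) (W : pregraphon R) (p : R) :=
  {ae gmu W, forall x, degree x = p}.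

Definition tensor_power (R : realType) (W : pregraphon R) (k : nat) : pregraphon R :=
  @Pregraphon R _ (k.-tuple (gspace W)) (tuple_power (gmu W) k)
    (fun z => \prod_(r < k) gfun W (tnth z.1 r, tnth z.2 r)).

Definition restriction (R : realType) (W : pregraphon R) (S : set (gspace W))
    (mS : measurable S) (S_gt0 : (0 < gmu W S)%E) : pregraphon R :=
  @Pregraphon R _ (restr_space S_gt0) (restr_measure S_gt0 mS)
    (fun z => gfun W (restr_val S_gt0 z.1, restr_val S_gt0 z.2)).

(* isomorphism everywhere rather than up to null sets: classes invariant under
   the latter are invariant under the former *)
Definition graphon_iso (R : realType) (W W' : pregraphon R) :=
  exists (f : gspace W -> gspace W') (g : gspace W' -> gspace W),
    [/\ cancel f g /\ cancel g f,
        measurable_fun setT f /\ measurable_fun setT g,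
        (forall A, measurable A -> gmu W' A = gmu W (f @^-1` A)) &
        (forall x y, gfun W' (f x, f y) = gfun W (x, y))].

Record admissible (R : realType) (C : pregraphon R -> Prop) : Prop := {
  admissible_graphon : forall W, C W -> is_graphon W;
  admissible_iso : forall W W', C W -> graphon_iso W W' -> C W';
  admissible_tensor : forall W k, C W -> (0 < k)%N -> C (tensor_power W k);
  admissible_restriction : forall W (S : set (gspace W)) (mS : measurable S)
    (S_gt0 : (0 < gmu W S)%E), C W -> C (restriction mS S_gt0) }.

Record sgraph := SGraph {
  svert : finType;
  sadj : rel svert;
  sadj_sym : symmetric sadj;
  sadj_irrefl : irreflexive sadj;
  sadj_nonempty : exists u v, sadj u v }.

(* the non-isolated vertices: isolated ones are deleted by convention, so that
   nvert, nedge and hom_density do not see them *)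
Definition vertex (H : sgraph) : finType :=
  {u : svert H | [exists v, @sadj H u v]}.

(* each edge is listed once, as a pair increasing in the enumeration order *)
Definition edges (H : sgraph) : {set vertex H * vertex H} :=
  [set e | sadj (val e.1) (val e.2) && (enum_rank e.1 < enum_rank e.2)%N].

Definition nvert (H : sgraph) : nat := #|vertex H|.
Definition nedge (H : sgraph) : nat := #|edges H|.

Definition hom_density (R : realType) (H : sgraph) (W : pregraphon R) : R :=
  \int[tuple_power (gmu W) #|vertex H|]_x
    \prod_(e in edges H) gfun W (tnth x (enum_rank e.1), tnth x (enum_rank e.2)).

Definition sidorenko (R : realType) (C : pregraphon R -> Prop) (H : sgraph) :=
  forall W, C W -> hom_density H W >= edge_density W ^+ nedge H.

(* Main.v *)
Require Import Defs.
From HB Require Import structures.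
From mathcomp Require Import all_boot all_order all_algebra.
From mathcomp Require Import all_classical all_reals all_analysis.
From mathcomp Require Import measurable_realfun ring lra.

(** Write p for the edge density of W, d for its degree function, m and n for
    the numbers of edges and vertices of H. If p = 0 then d, whose integral is
    p, vanishes almost everywhere. Suppose now that p > 0 and that d is not p
    almost everywhere. Then d / p is a probability density that is not 1
    almost everywhere, and on a high power of the space the product measure and
    its reweighting by the product of the d(x_i) / p concentrate on almost
    disjoint sets: some measurable set S of k-tuples has tiny measure a > 0 but
    carries almost all of the degree ([exists_separating_set]). The degree of
    the k-th tensor power of W at x is the product of the d(x_i), so S x S
    carries at least half of its edge mass p^k
    ([integral_square_lower_bound]).

    The class contains the restriction of the tensor power to S. Its edge
    density is at least (p^k / 2) / a^2. Its density of H is at most the density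
    p^(mk) of H in the tensor power, divided by a^n: here equality for W and
    multiplicativity enter ([hom_density_tensor_power],
    [hom_density_restriction_le]). The Sidorenko inequality then gives
    2^-m <= a^(2m - n) <= a ([sidorenko_restriction]), which is false when a is
    small enough.

    The set S is found with the Hellinger affinity r, the integral of
    sqrt (d / p), which is less than 1. If h(x) is the product of the
    sqrt (d(x_i) / p), then S := {h >= 1} works, because the integral r^k of h
    bounds both the measure of S and the share of the degree outside S. *)

Set Implicit Arguments.
Unset Strict Implicit.
Unset Printing Implicit Defensive.

Import Order.TTheory GRing.Theory Num.Theory.
Import numFieldNormedType.Exports.

Local Open Scope classical_set_scope.
Local Open Scope ring_scope.
Local Open Scope ereal_scope.

(** * Integrals against probability measures *)

Lemma integral_probability_cst d (T : measurableType d) (R : realType)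
  (P : probability T R) (c : R) : \int[P]_x c%:E = c%:E.
Proof. by rewrite integral_cst//= probability_setT mule1. Qed.

Lemma integral_EFin_bounded d (T : measurableType d) (R : realType)
    (P : probability T R) (f : T -> R) :
  measurable_fun setT f -> (forall x, 0 <= f x <= 1)%R ->
  \int[P]_x (f x)%:E = (\int[P]_x f x)%:E.
Proof.
move=> mf f01; rewrite /Rintegral fineK// ge0_fin_numE; last first.
  by apply: integral_ge0 => x _; rewrite lee_fin; case/andP: (f01 x).
apply: (@le_lt_trans _ _ (\int[P]_x 1%:E)); last first.
  by rewrite integral_probability_cst ltry.
apply: ge0_le_integral => //.
- by move=> x _; rewrite lee_fin; case/andP: (f01 x).
- exact/measurable_EFinP.
- by move=> x _; rewrite lee_fin; case/andP: (f01 x).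
Qed.

Lemma measurable_integral_snd d1 d2 (T : measurableType d1)
    (U : measurableType d2) (R : realType) (nu : probability U R)
    (f : T * U -> \bar R) :
  measurable_fun setT f -> (forall z, 0 <= f z) ->
  measurable_fun setT (fun x => \int[nu]_y f (x, y)).
Proof.
by move=> mf f0; exact: (measurable_fun_fubini_tonelli_F (m2 := nu) _ mf f0).
Qed.

(** * Integration over powers of a probability space *)

Section tuple_power_integral.
Context d (T : measurableType d) (R : realType) (mu : probability T R).

Lemma integral_tuple_power0 (f : 0.-tuple T -> \bar R) :
  measurable_fun [set: 0.-tuple T] f ->
  \int[tuple_power mu 0]_x f x = f [tuple].
Proof.
by move=> mf; rewrite /= integral_dirac// diracT mul1e.
Qed.

Lemma integral_tuple_powerS n (f : n.+1.-tuple T -> \bar R) :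
  measurable_fun [set: n.+1.-tuple T] f -> (forall x, 0 <= f x) ->
  \int[tuple_power mu n.+1]_x f x =
  \int[mu]_t \int[tuple_power mu n]_x f (tuple_cons (t, x)).
Proof.
move=> mf f0; rewrite /= ge0_integral_distribution//.
rewrite fubini_tonelli1//; last first.
  by move=> z; exact: f0.
exact: measurableT_comp mf (@measurable_tuple_cons _ T n).
Qed.

Lemma tnth_tuple_cons0 n (t : T) (x : n.-tuple T) :
  tnth (tuple_cons (t, x)) ord0 = t.
Proof. by []. Qed.

Lemma tnth_tuple_consS n (t : T) (x : n.-tuple T) (i : 'I_n) :
  tnth (tuple_cons (t, x)) (lift ord0 i) = tnth x i.
Proof. by rewrite tnthS. Qed.

Lemma measurable_prod_tnth n (g : 'I_n -> T -> R) :
  (forall i, measurable_fun setT (g i)) ->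
  measurable_fun [set: n.-tuple T] (fun x => \prod_(i < n) g i (tnth x i))%R.
Proof.
move=> mg; apply: measurable_prod => i _.
by apply: measurableT_comp => //; exact: measurable_tnth.
Qed.

(** Independence of the coordinates. The integrals of the factors are given as
    reals [c i], which avoids products in the extended reals. *)
Lemma integral_prod_tnth n (g : 'I_n -> T -> R) (c : 'I_n -> R) :
  (forall i, measurable_fun setT (g i)) -> (forall i t, 0 <= g i t)%R ->
  (forall i, \int[mu]_t (g i t)%:E = (c i)%:E) ->
  \int[tuple_power mu n]_x (\prod_(i < n) g i (tnth x i))%:E
  = (\prod_(i < n) c i)%:E.
Proof.
elim: n => [|n IHn] in g c * => mg g0 gc.
  rewrite integral_tuple_power0 ?big_ord0//.
  by under eq_fun do rewrite big_ord0; exact: measurable_cst.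
rewrite integral_tuple_powerS; last 2 first.
- by apply/measurable_EFinP; exact: measurable_prod_tnth.
- by move=> x; rewrite lee_fin prodr_ge0.
under eq_integral => t _.
  under eq_integral => x _.
    rewrite big_ord_recl tnth_tuple_cons0 EFinM.
    under eq_bigr do rewrite tnth_tuple_consS.
    over.
  rewrite ge0_integralZl_EFin//; last 2 first.
  - by move=> x _; rewrite lee_fin prodr_ge0.
  - apply/measurable_EFinP.
    exact: (measurable_prod_tnth (g := fun i => g (lift ord0 i))).
  rewrite (IHn (fun i => g (lift ord0 i)) (fun i => c (lift ord0 i)))//.
  over.
rewrite ge0_integralZr//; last 3 first.
- exact/measurable_EFinP.
- by move=> x _; rewrite lee_fin.
- rewrite lee_fin prodr_ge0// => i _; rewrite -lee_fin -gc integral_ge0// => x _.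
  by rewrite lee_fin.
by rewrite gc -EFinM big_ord_recl.
Qed.

End tuple_power_integral.

(** Let [lambda] be the image of [mu \x nu] under [phi]. Its powers are then the
    images of the products of the powers of [mu] and [nu]. The assumption on
    [lambda] has the form in which [integral_tuple_powerS] provides it for
    [phi := tuple_cons]. *)
Section zip_integral.
Context d1 d2 d3 (T : measurableType d1) (U : measurableType d2)
  (V : measurableType d3) (R : realType).
Variables (phi : T * U -> V) (mphi : measurable_fun setT phi).

Definition tuple_zip n (x : n.-tuple T) (y : n.-tuple U) : n.-tuple V :=
  [tuple phi (tnth x i, tnth y i) | i < n].

Lemma measurable_tuple_zip d' (X : measurableType d') n (a : X -> n.-tuple T)
    (b : X -> n.-tuple U) :
  measurable_fun setT a -> measurable_fun setT b ->
  measurable_fun setT (fun z => tuple_zip (a z) (b z)).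
Proof.
move=> ma mb; apply/measurable_fun_tnthP => i.
rewrite (_ : _ \o _ = phi \o (fun z => (tnth (a z) i, tnth (b z) i)));
  last first.
  by apply/funext => z /=; rewrite tnth_mktuple.
apply: measurableT_comp => //; apply: measurable_fun_pair.
  exact: (measurableT_comp (@measurable_tnth _ T n i) ma).
exact: (measurableT_comp (@measurable_tnth _ U n i) mb).
Qed.

Lemma tuple_zip_cons n t u (x : n.-tuple T) (y : n.-tuple U) :
  tuple_zip (tuple_cons (t, x)) (tuple_cons (u, y)) =
  tuple_cons (phi (t, u), tuple_zip x y).
Proof.
apply: eq_from_tnth => i; rewrite tnth_mktuple.
case: (unliftP ord0 i) => [j ->|->]; last by rewrite !tnth_tuple_cons0.
by rewrite !tnth_tuple_consS tnth_mktuple.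
Qed.

Variables (mu : probability T R) (nu : probability U R).
Variable lambda : probability V R.
Hypothesis lambdaE : forall f : V -> \bar R, measurable_fun setT f ->
  (forall v, 0 <= f v) ->
  \int[lambda]_v f v = \int[mu]_t \int[nu]_u f (phi (t, u)).

(** The induction adds one coordinate of each kind, so the new coordinate of the
    [U]-tuple has to move past the old coordinates of the [T]-tuple, by an
    exchange of integrals. *)
Lemma integral_tuple_zip n (f : n.-tuple V -> \bar R) :
  measurable_fun setT f -> (forall x, 0 <= f x) ->
  \int[tuple_power lambda n]_z f z =
  \int[tuple_power mu n]_x \int[tuple_power nu n]_y f (tuple_zip x y).
Proof.
elim: n => [|n IHn] in f * => mf f0.
  have mz : measurable_fun setT
      (fun z : 0.-tuple T * 0.-tuple U => f (tuple_zip z.1 z.2)).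
    apply: measurableT_comp => //; exact: measurable_tuple_zip.
  rewrite !integral_tuple_power0//.
  - by congr f; apply: eq_from_tnth => -[].
  - exact: (measurableT_comp mz (pair1_measurable _)).
  - exact: (measurable_integral_snd (tuple_power nu 0) mz _).
pose H := fun z : (V * n.-tuple T) * n.-tuple U =>
  f (tuple_cons (z.1.1, tuple_zip z.1.2 z.2)).
have mH : measurable_fun setT H.
  apply: (measurableT_comp mf).
  apply: (measurableT_comp (@measurable_tuple_cons _ V n)).
  apply: measurable_fun_pair.
    exact: (measurableT_comp measurable_fst measurable_fst).
  apply: measurable_tuple_zip; last exact: measurable_snd.
  exact: (measurableT_comp measurable_snd measurable_fst).
have H0 z : 0 <= H z by exact: f0.
pose G := fun z : V * n.-tuple T => \int[tuple_power nu n]_y H (z, y).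
have mG : measurable_fun setT G.
  exact: (measurable_integral_snd (tuple_power nu n) mH _).
have G0 z : 0 <= G z by apply: integral_ge0.
transitivity (\int[lambda]_v \int[tuple_power mu n]_x G (v, x)).
  rewrite integral_tuple_powerS//; apply: eq_integral => v _.
  rewrite IHn// => _.
  exact: (measurableT_comp mf (measurableT_comp (@measurable_tuple_cons _ V n)
    (pair1_measurable v))).
rewrite lambdaE; last 2 first.
- exact: (measurable_integral_snd (tuple_power mu n) mG _).
- by move=> v; apply: integral_ge0.
rewrite integral_tuple_powerS; last 2 first.
- apply: (measurable_integral_snd (tuple_power nu n.+1)
    (f := fun z => f (tuple_zip z.1 z.2))) => //.
  exact: (measurableT_comp mf
    (measurable_tuple_zip measurable_fst measurable_snd)).
- by move=> x; apply: integral_ge0.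
apply: eq_integral => t _.
have mK : measurable_fun setT (fun z : U * n.-tuple T => G (phi (t, z.1), z.2)).
  apply: (measurableT_comp mG); apply: measurable_fun_pair => //.
  apply: (measurableT_comp mphi); apply: measurable_fun_pair => //.
rewrite (fubini_tonelli _ mK)//; apply: eq_integral => x _.
rewrite integral_tuple_powerS//; last first.
  exact: (measurableT_comp mf
    (measurable_tuple_zip (measurable_cst _) (@measurable_id _ _ _))).
apply: eq_integral => u _; apply: eq_integral => y _.
by rewrite tuple_zip_cons.
Qed.

End zip_integral.

Section tensor_integral.
Context d (T : measurableType d) (R : realType) (mu : probability T R).

Definition column n k (r : 'I_k) (X : n.-tuple (k.-tuple T)) : n.-tuple T :=
  [tuple tnth (tnth X i) r | i < n].

Lemma measurable_column n k (r : 'I_k) :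
  measurable_fun [set: n.-tuple (k.-tuple T)] (column r).
Proof.
apply/measurable_fun_tnthP => i.
rewrite (_ : _ \o _ = (fun y : k.-tuple T => tnth y r) \o
    (fun X : n.-tuple (k.-tuple T) => tnth X i)); last first.
  by apply/funext => X /=; rewrite tnth_mktuple.
exact: (measurableT_comp (@measurable_tnth _ T k r)
  (@measurable_tnth _ (k.-tuple T) n i)).
Qed.

Lemma measurable_prod_column n k (F : n.-tuple T -> R) :
  measurable_fun setT F ->
  measurable_fun [set: n.-tuple (k.-tuple T)]
    (fun X => \prod_(r < k) F (column r X))%R.
Proof.
move=> mF; apply: measurable_prod => r _.
exact: (measurableT_comp mF (@measurable_column n k r)).
Qed.

(** An [n]-tuple of [k]-tuples is an [n] by [k] array, and its [k] columns are
    independent: this is why homomorphism densities are multiplicative under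
    tensor powers. The induction splits off one column, which is the case
    [phi := tuple_cons] of [integral_tuple_zip]. *)
Lemma integral_prod_column n k (F : n.-tuple T -> R) (c : R) :
  measurable_fun setT F -> (forall x, 0 <= F x)%R ->
  \int[tuple_power mu n]_x (F x)%:E = c%:E ->
  \int[tuple_power (tuple_power mu k) n]_X (\prod_(r < k) F (column r X))%:E
  = (c ^+ k)%:E.
Proof.
move=> mF F0 Fc; elim: k => [|k IHk].
  under eq_integral do rewrite big_ord0.
  by rewrite expr0; exact: integral_probability_cst.
rewrite (@integral_tuple_zip _ _ _ _ _ _ _ (@tuple_cons _ T k)
  (@measurable_tuple_cons _ T k) mu (tuple_power mu k)); last 3 first.
- by move=> f mf f0; rewrite integral_tuple_powerS.
- by apply/measurable_EFinP; exact: measurable_prod_column.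
- by move=> X; rewrite lee_fin prodr_ge0.
under eq_integral => x _.
  under eq_integral => Y _.
    rewrite big_ord_recl EFinM.
    rewrite (_ : column ord0 _ = x); last first.
      by apply: eq_from_tnth => i; rewrite !tnth_mktuple tnth_tuple_cons0.
    rewrite (eq_bigr (fun r => F (column r Y))); last first.
      move=> r _; congr F; apply: eq_from_tnth => i.
      by rewrite !tnth_mktuple tnth_tuple_consS.
    over.
  rewrite ge0_integralZl_EFin//; last 2 first.
  - by move=> Y _; rewrite lee_fin prodr_ge0.
  - by apply/measurable_EFinP; exact: measurable_prod_column.
  rewrite IHk; over.
rewrite ge0_integralZr//; last 3 first.
- exact/measurable_EFinP.
- by move=> x _; rewrite lee_fin.
- rewrite lee_fin exprn_ge0// -lee_fin -Fc integral_ge0// => x _.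
  by rewrite lee_fin.
by rewrite Fc -EFinM exprS.
Qed.

End tensor_integral.

(** If the image of [nu] under [phi] has density at most [c] with respect to
    [mu], then the image of the [n]-th power has density at most [c ^+ n]. For
    the normalized restriction to [S], this bounds a homomorphism density by
    the same integral over the whole space. *)
Section domination.
Context d1 d2 (U : measurableType d1) (T : measurableType d2) (R : realType).
Variables (phi : U -> T) (mphi : measurable_fun setT phi).
Variables (nu : probability U R) (mu : probability T R) (c : R).
Hypothesis c0 : (0 <= c)%R.
Hypothesis nu_le : forall f : T -> \bar R, measurable_fun setT f ->
  (forall t, 0 <= f t) -> \int[nu]_u f (phi u) <= c%:E * \int[mu]_t f t.

Lemma measurable_map_tuple n :
  measurable_fun [set: n.-tuple U] (map_tuple phi).
Proof.
apply/measurable_fun_tnthP => i.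
rewrite (_ : _ \o _ = phi \o (fun x => tnth x i)); last first.
  by apply/funext => X /=; rewrite tnth_map.
exact: (measurableT_comp mphi (@measurable_tnth _ U n i)).
Qed.

Lemma map_tuple_cons n u (x : n.-tuple U) :
  map_tuple phi (tuple_cons (u, x)) = tuple_cons (phi u, map_tuple phi x).
Proof.
apply: eq_from_tnth => i; rewrite tnth_map.
case: (unliftP ord0 i) => [j ->|->]; last by rewrite !tnth_tuple_cons0.
by rewrite !tnth_tuple_consS tnth_map.
Qed.

Lemma integral_map_tuple_le n (f : n.-tuple T -> \bar R) :
  measurable_fun setT f -> (forall x, 0 <= f x) ->
  \int[tuple_power nu n]_x f (map_tuple phi x) <=
  (c ^+ n)%:E * \int[tuple_power mu n]_x f x.
Proof.
elim: n => [|n IHn] in f * => mf f0.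
  rewrite !integral_tuple_power0//; last first.
    exact: (measurableT_comp mf (@measurable_map_tuple _)).
  rewrite expr0 mul1e (_ : map_tuple phi _ = [tuple])//.
  by apply: eq_from_tnth => -[].
have mfc : measurable_fun setT (fun z : T * n.-tuple T => f (tuple_cons z)).
  exact: (measurableT_comp mf (@measurable_tuple_cons _ T n)).
have mF := measurable_integral_snd (tuple_power mu n) mfc (fun z => f0 _).
have mg : measurable_fun setT
    (fun z : U * n.-tuple U => f (tuple_cons (phi z.1, map_tuple phi z.2))).
  apply: (measurableT_comp mfc); apply: measurable_fun_pair.
    exact: (measurableT_comp mphi measurable_fst).
  exact: (measurableT_comp (@measurable_map_tuple n) measurable_snd).
have mG := measurable_integral_snd (tuple_power nu n) mg (fun z => f0 _).
rewrite !integral_tuple_powerS//; last first.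
  exact: (measurableT_comp mf (@measurable_map_tuple n.+1)).
under eq_integral do under eq_integral do rewrite map_tuple_cons.
have cF0 t : 0 <= \int[tuple_power mu n]_x f (tuple_cons (t, x)).
  exact: integral_ge0.
apply: (@le_trans _ _ (\int[nu]_u ((c ^+ n)%:E *
    \int[tuple_power mu n]_x f (tuple_cons (phi u, x))))).
  apply: ge0_le_integral => //.
  - by move=> u _; exact: integral_ge0.
  - by apply: measurable_funeM; exact: (measurableT_comp mF mphi).
  move=> u _; apply: (IHn (fun x => f (tuple_cons (phi u, x)))) => //.
  exact: (measurableT_comp mfc (pair1_measurable _)).
rewrite ge0_integralZl_EFin//; last 2 first.
- exact: (measurableT_comp mF mphi).
- exact: exprn_ge0.
rewrite exprSr EFinM -muleA; apply: lee_wpmul2l.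
  by rewrite lee_fin exprn_ge0.
exact: nu_le.
Qed.

End domination.

Section restriction_integral.
Context d (T : measurableType d) (R : realType) (mu : probability T R).
Context (S : set T) (mS : measurable S) (S_gt0 : 0 < mu S).

Lemma measurable_restr_val :
  measurable_fun [set: restr_space S_gt0] (restr_val S_gt0).
Proof. by move=> _ B mB; exists B. Qed.

(** The image of the restricted measure gives the complement of [S] measure
    zero, and agrees inside [S] with a multiple of [mu]. *)
Lemma integral_restr (f : T -> \bar R) :
  measurable_fun setT f -> (forall t, 0 <= f t) ->
  \int[restr_measure S_gt0 mS]_x f (restr_val S_gt0 x) =
  ((fine (mu S))^-1)%:E * \int[mu]_(t in S) f t.
Proof.
move=> mf f0.
pose val_mfun : {mfun restr_space S_gt0 >-> T} :=
  HB.pack (restr_val S_gt0)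
    (isMeasurableFun.Build _ _ _ _ _ measurable_restr_val).
have a0 : (0 <= (fine (mu S))^-1)%R by rewrite invr_ge0 fine_ge0.
have E A : distribution (restr_measure S_gt0 mS) val_mfun A =
    ((fine (mu S))^-1)%:E * mu (A `&` S).
  rewrite /distribution /pushforward /= /restr_measure muleC; congr (_ * mu _).
  apply/seteqP; split => [_ [x Ax <-]|t [At St]].
    by split => //; exact: set_mem (valP x).
  by exists (exist _ t (mem_set St)).
transitivity (\int[distribution (restr_measure S_gt0 mS) val_mfun]_t f t).
  by rewrite ge0_integral_distribution.
rewrite (@ge0_negligible_integral _ _ _ _ _ (~` S))//; last 2 first.
- exact: measurableC.
- by apply: etrans (E _) _; rewrite setICl measure0 mule0.
rewrite setTD setCK.
rewrite (@eq_measure_integral _ _ _ _ (mscale (NngNum a0) mu)); last first.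
  by move=> A mA AS; apply: etrans (E _) _; rewrite setIidl.
rewrite ge0_integral_mscale//; exact: measurable_funTS.
Qed.

End restriction_integral.

(** * Telling a density apart from 1 in high powers *)

Section tilting.
Context d (T : measurableType d) (R : realType) (mu : probability T R).

(** Strict Cauchy-Schwarz for a density [u ^+ 2], read off from
    2 u + (u - 1)^2 = u^2 + 1: the integral of u falls short of 1 by half the
    integral of (u - 1)^2, which is positive unless u is 1 almost everywhere. *)
Lemma integral_sqrt_density_lt1 (u : T -> R) :
  measurable_fun setT u -> (forall x, 0 <= u x)%R ->
  \int[mu]_x (u x ^+ 2)%:E = 1 -> ~ {ae mu, forall x, (u x ^+ 2 = 1)%R} ->
  exists2 r : R, (0 <= r < 1)%R & \int[mu]_x (u x)%:E = r%:E.
Proof.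
move=> mu_ u0 u1 nae.
have mu2 : measurable_fun setT (fun x => (u x - 1) ^+ 2)%R.
  by apply: measurable_funX; apply: measurable_funB.
have I0 : 0 <= \int[mu]_x (u x)%:E.
  by apply: integral_ge0 => x _; rewrite lee_fin.
have J0 : 0 <= \int[mu]_x ((u x - 1) ^+ 2)%:E.
  by apply: integral_ge0 => x _; rewrite lee_fin sqr_ge0.
have : \int[mu]_x ((u x ^+ 2)%:E + 1%:E) =
    \int[mu]_x ((u x)%:E + (u x)%:E + ((u x - 1) ^+ 2)%:E).
  by apply: eq_integral => x _; rewrite -!EFinD; congr (_%:E); ring.
rewrite ge0_integralD//; last 2 first.
- by move=> x _; rewrite lee_fin sqr_ge0.
- by apply/measurable_EFinP; apply: measurable_funX.
rewrite u1 integral_probability_cst.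
rewrite ge0_integralD//; last 4 first.
- by move=> x _; rewrite -EFinD lee_fin addr_ge0.
- by apply/measurable_EFinP; apply: measurable_funD.
- by move=> x _; rewrite lee_fin sqr_ge0.
- exact/measurable_EFinP.
rewrite ge0_integralD//; last 4 first.
- by move=> x _; rewrite lee_fin.
- exact/measurable_EFinP.
- by move=> x _; rewrite lee_fin.
- exact/measurable_EFinP.
have : \int[mu]_x ((u x - 1) ^+ 2)%:E != 0.
  apply/eqP => J; apply: nae.
  have /ae_eq_integral_abs : \int[mu]_x `|((u x - 1) ^+ 2)%:E| = 0.
    rewrite -[RHS]J; apply: eq_integral => x _.
    by rewrite gee0_abs// lee_fin sqr_ge0.
  move=> /(_ measurableT) H.
  have {}H := H ((measurable_EFinP _ _).2 mu2).
  apply: filterS H => x /(_ I) /= [] /eqP; rewrite sqrf_eq0 subr_eq0 => /eqP ->.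
  by rewrite expr1n.
move: I0 J0; case: (\int[mu]_x (u x)%:E) => [r| |] //=; last first.
  by case: (\int[mu]_x ((u x - 1) ^+ 2)%:E) => [s| |].
case: (\int[mu]_x ((u x - 1) ^+ 2)%:E) => [s| |] //=.
rewrite !lee_fin => r0 s0 sn0; rewrite -!EFinD => -[E].
exists r => //; rewrite r0/=.
have : (0 < s)%R by rewrite lt_neqAle eq_sym sn0.
lra.
Qed.

Variables (h : T -> R) (mh : measurable_fun setT h).
Hypothesis h0 : forall x, (0 <= h x)%R.

Let mge1 : measurable [set x | (1 <= h x)%R].
Proof. by rewrite -[X in measurable X]setTI; exact: measurable_fun_le. Qed.

(** In this lemma and the next, [h] is the square root of a likelihood ratio:
    where it is at least 1, it bounds the constant 1; elsewhere, it bounds its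
    own square. So the integral of [h] bounds both error probabilities of the
    likelihood ratio test. *)
Lemma measure_ge1_le : mu [set x | (1 <= h x)%R] <= \int[mu]_x (h x)%:E.
Proof.
rewrite -[X in mu X]setIT -integral_indic//.
apply: ge0_le_integral => //.
- by apply/measurable_EFinP; apply: measurable_indic.
- exact/measurable_EFinP.
- move=> x _; rewrite lee_fin indicE; case: (boolP (_ \in _)) => //.
  by rewrite inE.
Qed.

Lemma integral_sqr_lt1_le :
  \int[mu]_(x in ~` [set x | (1 <= h x)%R]) (h x ^+ 2)%:E <=
  \int[mu]_x (h x)%:E.
Proof.
have mC := measurableC mge1.
apply: (@le_trans _ _ (\int[mu]_(x in ~` [set x | (1 <= h x)%R]) (h x)%:E)).
  apply: ge0_le_integral => //.
  - by move=> x _; rewrite lee_fin sqr_ge0.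
  - by apply/measurable_EFinP; apply: measurable_funTS; apply: measurable_funX.
  - by apply/measurable_EFinP; apply: measurable_funTS.
  move=> x /= /negP; rewrite -ltNge => hx.
  by rewrite lee_fin expr2 ler_piMl// ltW.
apply: ge0_subset_integral => //; first exact/measurable_EFinP.
by move=> x _; rewrite lee_fin.
Qed.

End tilting.

Lemma small_power (R : realType) (r e : R) :
  (0 <= r < 1 -> 0 < e -> exists k, r ^+ k < e)%R.
Proof.
move=> /andP[r0 r1] e0.
have /cvgr0Pnorm_lt /(_ _ e0) [N _ /(_ N (leqnn _))] :
  (r ^+ n)%R @[n --> \oo] --> (0 : R)%R by apply: cvg_expr; rewrite ger0_norm.
by rewrite /= ger0_norm ?exprn_ge0// => rN; exists N.
Qed.

(** Put [u := sqrt (f / p)], whose integral [r] is less than 1. On the [k]-th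
    power the product of the [u (x_i)] has integral [r ^+ k], so the likelihood
    ratio test between the powers of [mu] and of its reweighting by [f / p] has
    both errors at most [r ^+ k]. *)
Lemma exists_separating_set d (T : measurableType d) (R : realType)
    (mu : probability T R) (f : T -> R) (p e : R) :
  measurable_fun setT f -> (forall x, 0 <= f x)%R -> (0 < p)%R ->
  \int[mu]_x (f x)%:E = p%:E -> ~ {ae mu, forall x, f x = p} ->
  (0 < e <= 1)%R ->
  exists k (S : set (k.-tuple T)),
    [/\ (0 < k)%N, measurable S, tuple_power mu k S <= e%:E &
      \int[tuple_power mu k]_(x in ~` S) (\prod_(i < k) f (tnth x i))%:E
      <= (p ^+ k * e)%:E].
Proof.
move=> mf f0 p0 fp nae /andP[e0 e1].
pose u x := Num.sqrt (f x / p).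
have u0 x : (0 <= u x)%R by exact: sqrtr_ge0.
have u2 x : (u x ^+ 2 = f x / p)%R by rewrite sqr_sqrtr// divr_ge0// ltW.
have mu_ : measurable_fun setT u.
  apply: (measurableT_comp (continuous_measurable_fun (@sqrt_continuous R))).
  exact: measurable_funM.
have [||r r01 uE] := integral_sqrt_density_lt1 (mu := mu) mu_ u0.
- under eq_integral do rewrite u2 mulrC EFinM.
  rewrite ge0_integralZl_EFin//.
  + by rewrite fp -EFinM mulVf// gt_eqF.
  + by move=> x _; rewrite lee_fin.
  + exact/measurable_EFinP.
  + by rewrite invr_ge0 ltW.
- move=> ae1; apply: nae; apply: filterS ae1 => x.
  by rewrite u2 => /(canRL (divfK _)) ->; rewrite ?mul1r// gt_eqF.
have [k rk] := small_power r01 e0.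
have k0 : (0 < k)%N.
  by rewrite lt0n; apply/eqP => k0; move: rk; rewrite k0 expr0 ltNge e1.
pose h (x : k.-tuple T) := (\prod_(i < k) u (tnth x i))%R.
have mh : measurable_fun setT h by exact: (measurable_prod_tnth (fun=> mu_)).
have h0 x : (0 <= h x)%R by exact: prodr_ge0.
have hE : \int[tuple_power mu k]_x (h x)%:E = (r ^+ k)%:E.
  rewrite (_ : (r ^+ k = \prod_(i < k) r)%R); last first.
    by rewrite prodr_const card_ord.
  exact: (integral_prod_tnth (fun=> mu_)).
have h2 x : (\prod_(i < k) f (tnth x i) = p ^+ k * h x ^+ 2)%R.
  rewrite /h -prodrXl -[k in (p ^+ k)%R]card_ord.
  rewrite -prodr_const -big_split/=; apply: eq_bigr => i _.
  by rewrite u2 mulrC divfK// gt_eqF.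
have mS : measurable [set x | (1 <= h x)%R].
  by rewrite -[X in measurable X]setTI; exact: measurable_fun_le.
exists k, [set x | (1 <= h x)%R]; split => //.
  by apply: (le_trans (measure_ge1_le _ mh h0)); rewrite hE lee_fin ltW.
under eq_integral do rewrite h2 EFinM.
rewrite ge0_integralZl_EFin//; last 4 first.
- exact: measurableC.
- by move=> x _; rewrite lee_fin sqr_ge0.
- by apply/measurable_EFinP; apply: measurable_funTS; apply: measurable_funX.
- by apply: exprn_ge0; exact: ltW.
rewrite EFinM; apply: lee_wpmul2l; first by rewrite lee_fin exprn_ge0// ltW.
by apply: (le_trans (integral_sqr_lt1_le _ mh h0)); rewrite hE lee_fin ltW.
Qed.

(** * Edge mass inside a set of vertices *)

Section edge_mass.
Context d (T : measurableType d) (R : realType) (mu : probability T R).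
Variables (w : T * T -> R) (mw : measurable_fun setT w).
Hypotheses (w0 : forall z, (0 <= w z)%R) (wC : forall x y, w (x, y) = w (y, x)).
Variables (S : set T) (mS : measurable S).

Lemma measurable_integral_section :
  measurable_fun setT (fun x => \int[mu]_(y in S) (w (x, y))%:E).
Proof.
apply: (eq_measurable_fun (fun x => \int[mu]_y (w (x, y) * \1_S y)%:E)).
  move=> x _; rewrite [RHS]integral_mkcond; apply: eq_integral => y _.
  by rewrite patchE indicE; case: ifPn => _; rewrite ?mulr1 ?mulr0.
apply: (measurable_integral_snd mu (f := fun z => (w z * \1_S z.2)%:E)).
  apply/measurable_EFinP; apply: measurable_funM => //.
  have mS1 : measurable_fun setT (\1_S : T -> R) by exact: measurable_indic.
  exact: (measurableT_comp mS1 measurable_snd).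
by move=> z; rewrite lee_fin mulr_ge0// indicE.
Qed.

(** An edge that is not inside [S] has an endpoint outside [S], so the lost mass
    is at most twice the total degree of the complement. *)
Lemma integral_square_lower_bound :
  \int[(mu \x mu)]_z (w z)%:E <=
  \int[mu]_(x in S) \int[mu]_(y in S) (w (x, y))%:E +
  (\int[mu]_(x in ~` S) \int[mu]_y (w (x, y))%:E +
   \int[mu]_(x in ~` S) \int[mu]_y (w (x, y))%:E).
Proof.
have mSC := measurableC mS.
(* [a], [b], [c]: edges inside [S], with first endpoint outside [S], and with
   second endpoint outside [S] *)
pose a z := (w z * \1_S z.1 * \1_S z.2)%R.
pose b z := (w z * \1_(~` S) z.1)%R.
pose c z := (w z * \1_(~` S) z.2)%R.
have mI (A : set T) : measurable A -> measurable_fun setT (\1_A : T -> R).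
  by move=> mA; apply: measurable_indic.
have m1 (A : set T) : measurable A ->
    measurable_fun setT (fun z : T * T => \1_A z.1 : R).
  by move=> mA; exact: (measurableT_comp (mI _ mA) measurable_fst).
have m2 (A : set T) : measurable A ->
    measurable_fun setT (fun z : T * T => \1_A z.2 : R).
  by move=> mA; exact: (measurableT_comp (mI _ mA) measurable_snd).
have i0 (A : set T) x : (0 <= \1_A x :> R)%R by rewrite indicE.
have ma : measurable_fun setT a.
  apply: measurable_funM; last exact: m2.
  by apply: measurable_funM => //; exact: m1.
have mb : measurable_fun setT b by apply: measurable_funM => //; exact: m1.
have mc : measurable_fun setT c by apply: measurable_funM => //; exact: m2.
have a0 z : 0 <= (a z)%:E by rewrite lee_fin !mulr_ge0.
have b0 z : 0 <= (b z)%:E by rewrite lee_fin !mulr_ge0.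
have c0 z : 0 <= (c z)%:E by rewrite lee_fin !mulr_ge0.
have bE : \int[(mu \x mu)]_z (b z)%:E =
    \int[mu]_(x in ~` S) \int[mu]_y (w (x, y))%:E.
  rewrite (fubini_tonelli1 _ ((measurable_EFinP _ _).2 mb) b0).
  rewrite [RHS]integral_mkcond; apply: eq_integral => x _.
  rewrite /fubini_F patchE /b /= indicE; case: ifPn => xS.
    by apply: eq_integral => y _; rewrite mulr1.
  by rewrite integral0_eq// => y _; rewrite mulr0.
have cE : \int[(mu \x mu)]_z (c z)%:E =
    \int[mu]_(x in ~` S) \int[mu]_y (w (x, y))%:E.
  rewrite (fubini_tonelli2 _ ((measurable_EFinP _ _).2 mc) c0).
  rewrite [RHS]integral_mkcond; apply: eq_integral => x _.
  rewrite /fubini_G patchE /c /= indicE; case: ifPn => xS.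
    by apply: eq_integral => y _; rewrite mulr1 wC.
  by rewrite integral0_eq// => y _; rewrite mulr0.
have aE : \int[(mu \x mu)]_z (a z)%:E =
    \int[mu]_(x in S) \int[mu]_(y in S) (w (x, y))%:E.
  rewrite (fubini_tonelli1 _ ((measurable_EFinP _ _).2 ma) a0).
  rewrite [RHS]integral_mkcond; apply: eq_integral => x _.
  rewrite /fubini_F patchE /a /= (indicE _ S x); case: ifPn => xS.
    rewrite [RHS]integral_mkcond; apply: eq_integral => y _.
    by rewrite patchE indicE mulr1; case: ifPn => _; rewrite ?mulr1 ?mulr0.
  by rewrite integral0_eq// => y _; rewrite mulr0 mul0r.
rewrite -aE -{1}bE -cE -ge0_integralD//; last 2 first.
- exact/measurable_EFinP.
- exact/measurable_EFinP.
rewrite -ge0_integralD//; last 3 first.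
- exact/measurable_EFinP.
- by move=> z _; exact: adde_ge0.
- by apply: emeasurable_funD; exact/measurable_EFinP.
apply: ge0_le_integral => //.
- by move=> z _; rewrite lee_fin.
- exact/measurable_EFinP.
- apply: emeasurable_funD; first exact/measurable_EFinP.
  by apply: emeasurable_funD; exact/measurable_EFinP.
move=> z _; rewrite -!EFinD lee_fin /a /b /c !indicE !in_setC.
case: (_ \in S); case: (_ \in S) => /=; rewrite ?mulr1 ?mulr0 ?addr0 ?add0r//.
by rewrite lerDl.
Qed.

End edge_mass.

(** * Densities of graphons, of their tensor powers and of their restrictions *)

Section graphon.
Context (R : realType) (W : pregraphon R) (gW : is_graphon W).
Implicit Types H : sgraph.

Local Notation mu := (gmu W).
Local Notation w := (gfun W).

Lemma gfun_ge0 z : (0 <= w z)%R.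
Proof. by case: gW z => _ _ _ _ w01 [x y]; case/andP: (w01 x y). Qed.

Lemma gfun_le1 z : (w z <= 1)%R.
Proof. by case: gW z => _ _ _ _ w01 [x y]; case/andP: (w01 x y). Qed.

Lemma measurable_gfun : measurable_fun setT w.
Proof. by case: gW. Qed.

Lemma gfunC x y : w (x, y) = w (y, x).
Proof. by case: gW. Qed.

Lemma edge_densityE : (edge_density W)%:E = \int[(mu \x mu)]_z (w z)%:E.
Proof.
rewrite integral_EFin_bounded//; first exact: measurable_gfun.
by move=> z; rewrite gfun_ge0 gfun_le1.
Qed.

Lemma degreeE x : (degree x)%:E = \int[mu]_y (w (x, y))%:E.
Proof.
rewrite integral_EFin_bounded//.
  exact: (measurableT_comp measurable_gfun (pair1_measurable x)).
by move=> y; rewrite gfun_ge0 gfun_le1.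
Qed.

Lemma measurable_degree : measurable_fun setT (@degree R W).
Proof.
apply/measurable_EFinP.
rewrite (_ : _ \o _ = fun x => \int[mu]_y (w (x, y))%:E).
  apply: (measurable_integral_snd mu (f := fun z => (w z)%:E)).
    by apply/measurable_EFinP; exact: measurable_gfun.
  by move=> z; rewrite lee_fin gfun_ge0.
by apply/funext => x /=; rewrite degreeE.
Qed.

Lemma degree_ge0 x : (0 <= @degree R W x)%R.
Proof.
rewrite -lee_fin degreeE; apply: integral_ge0 => y _.
by rewrite lee_fin gfun_ge0.
Qed.

Lemma integral_degree : \int[mu]_x (@degree R W x)%:E = (edge_density W)%:E.
Proof.
have mE : measurable_fun setT (fun z => (w z)%:E).
  by apply/measurable_EFinP; exact: measurable_gfun.
rewrite edge_densityE (fubini_tonelli1 _ mE); last first.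
  by move=> z; rewrite lee_fin gfun_ge0.
by apply: eq_integral => x _; rewrite degreeE.
Qed.

Definition hom_weight H (x : #|vertex H|.-tuple (gspace W)) : R :=
  (\prod_(e in edges H) w (tnth x (enum_rank e.1), tnth x (enum_rank e.2)))%R.

Lemma hom_weight_ge0 H x : (0 <= @hom_weight H x)%R.
Proof. by apply: prodr_ge0 => e _; exact: gfun_ge0. Qed.

Lemma measurable_hom_weight H : measurable_fun setT (@hom_weight H).
Proof.
apply: (eq_measurable_fun (fun x => \prod_(e <- enum (edges H))
    w (tnth x (enum_rank e.1), tnth x (enum_rank e.2)))%R).
  by move=> x _; rewrite /hom_weight big_enum.
apply: measurable_prod => e _.
apply: (measurableT_comp measurable_gfun); apply: measurable_fun_pair;
exact: measurable_tnth.
Qed.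

Lemma hom_densityE H :
  (hom_density H W)%:E = \int[tuple_power mu #|vertex H|]_x (hom_weight x)%:E.
Proof.
rewrite integral_EFin_bounded//; first exact: measurable_hom_weight.
move=> x; rewrite hom_weight_ge0/=; apply: prodr_ile1 => e _.
by rewrite gfun_ge0 gfun_le1.
Qed.

End graphon.

Section tensor.
Context (R : realType) (W : pregraphon R) (k : nat).
Hypotheses (gW : is_graphon W) (gWk : is_graphon (tensor_power W k)).

Lemma degree_tensor_power (x : k.-tuple (gspace W)) :
  @degree R (tensor_power W k) x =
  (\prod_(r < k) @degree R W (tnth x r))%R.
Proof.
apply: EFin_inj; rewrite (degreeE gWk) /=.
apply: (integral_prod_tnth (g := fun r y => gfun W (tnth x r, y))).
- move=> r.
  exact: (measurableT_comp (measurable_gfun gW) (pair1_measurable _)).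
- by move=> r y; exact: gfun_ge0.
- by move=> r; rewrite -degreeE.
Qed.

Lemma edge_density_tensor_power :
  edge_density (tensor_power W k) = (edge_density W ^+ k)%R.
Proof.
apply: EFin_inj; rewrite -(integral_degree gWk).
under eq_integral do rewrite degree_tensor_power.
rewrite -[k in RHS]card_ord -prodr_const.
apply: (integral_prod_tnth (g := fun=> @degree R W)).
- by move=> r; exact: measurable_degree.
- by move=> r x; exact: degree_ge0.
- by move=> r; exact: integral_degree.
Qed.

Lemma hom_density_tensor_power H :
  hom_density H (tensor_power W k) = (hom_density H W ^+ k)%R.
Proof.
apply: EFin_inj; rewrite (hom_densityE gWk).
rewrite -(integral_prod_column k (measurable_hom_weight gW (H := H))
  (hom_weight_ge0 gW (H := H)) (esym (hom_densityE gW H))).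
apply: eq_integral => X _; rewrite /hom_weight exchange_big/=.
congr (_%:E); apply: eq_bigr => r _; apply: eq_bigr => e _.
by rewrite !tnth_mktuple.
Qed.

End tensor.

Section restriction.
Context (R : realType) (W : pregraphon R) (gW : is_graphon W).
Context (S : set (gspace W)) (mS : measurable S) (S_gt0 : 0 < gmu W S).
Hypothesis gWS : is_graphon (restriction mS S_gt0).

Local Notation mu := (gmu W).
Local Notation w := (gfun W).
Local Notation a := (fine (gmu W S)).

Let a_gt0 : (0 < a)%R.
Proof. by rewrite fine_gt0// S_gt0 ltey_eq fin_num_measure. Qed.

Lemma edge_density_restriction :
  (edge_density (restriction mS S_gt0))%:E =
  (a ^-2)%:E * \int[mu]_(x in S) \int[mu]_(y in S) (w (x, y))%:E.
Proof.
have mE : measurable_fun setT (fun z => (gfun (restriction mS S_gt0) z)%:E).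
  by apply/measurable_EFinP; exact: (measurable_gfun gWS).
have mF : measurable_fun setT (fun z => (w z)%:E).
  by apply/measurable_EFinP; exact: measurable_gfun.
have mI := measurable_integral_section mu (measurable_gfun gW) (gfun_ge0 gW) mS.
rewrite (edge_densityE gWS) (fubini_tonelli1 _ mE); last first.
  by move=> z; rewrite lee_fin (gfun_ge0 gWS).
under eq_integral => x _.
  rewrite /fubini_F /=.
  rewrite (integral_restr mS S_gt0
    (f := fun y => (w (restr_val S_gt0 x, y))%:E)).
  - over.
  - exact: (measurableT_comp mF (pair1_measurable _)).
  - by move=> y; rewrite lee_fin gfun_ge0.
rewrite (integral_restr mS S_gt0
  (f := fun x => (a^-1)%:E * \int[mu]_(y in S) (w (x, y))%:E)).
- rewrite ge0_integralZl_EFin//.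
  + by rewrite muleA -EFinM -expr2 exprVn.
  + by move=> x _; apply: integral_ge0 => y _; rewrite lee_fin gfun_ge0.
  + exact: measurable_funTS.
  + by rewrite invr_ge0 ltW.
- exact: measurable_funeM.
- move=> x; apply: mule_ge0; first by rewrite lee_fin invr_ge0 ltW.
  by apply: integral_ge0 => y _; rewrite lee_fin gfun_ge0.
Qed.

Lemma hom_density_restriction_le H :
  (hom_density H (restriction mS S_gt0) <= a ^- nvert H * hom_density H W)%R.
Proof.
rewrite -lee_fin EFinM (hom_densityE gWS) (hom_densityE gW) -exprVn.
rewrite (eq_integral (fun x => (hom_weight (W := W) (H := H)
    (map_tuple (restr_val S_gt0 : restr_space S_gt0 -> _) x))%:E)); last first.
  move=> x _; rewrite /hom_weight; congr (_%:E).
  by apply: eq_bigr => e _; rewrite !tnth_map.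
have nu_le (f : gspace W -> \bar R) : measurable_fun setT f ->
    (forall t, 0 <= f t) ->
    \int[restr_measure S_gt0 mS]_u f (restr_val S_gt0 u) <=
    (a^-1)%:E * \int[mu]_t f t.
  move=> mf f0; rewrite integral_restr//.
  apply: lee_wpmul2l; first by rewrite lee_fin invr_ge0 ltW.
  exact: ge0_subset_integral.
apply: (integral_map_tuple_le (@measurable_restr_val _ _ _ mu _ S_gt0) _ nu_le
  (f := fun x => (hom_weight x)%:E)).
- by rewrite invr_ge0 ltW.
- by apply/measurable_EFinP; exact: measurable_hom_weight.
- by move=> x; rewrite lee_fin hom_weight_ge0.
Qed.

End restriction.

(** The Sidorenko inequality for the restriction to [S], with the normalizations
    cleared: with [a] the measure of [S], the edge mass contributes a factor
    [a ^- 2] per edge and the homomorphism density loses at most a factor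
    [a ^- 1] per vertex. The exponent that remains is positive exactly when
    2 e(H) > v(H). *)
Lemma sidorenko_restriction (R : realType) (C : pregraphon R -> Prop)
    (H : sgraph) (W : pregraphon R) (S : set (gspace W)) (b : R) :
  admissible C -> sidorenko C H -> C W -> measurable S -> 0 < gmu W S ->
  (nvert H <= 2 * nedge H)%N -> (0 <= b)%R ->
  b%:E <= \int[gmu W]_(x in S) \int[gmu W]_(y in S) (gfun W (x, y))%:E ->
  (b ^+ nedge H <=
     fine (gmu W S) ^+ (2 * nedge H - nvert H) * hom_density H W)%R.
Proof.
move=> adm sid CW mS S_gt0 vn b0 b_le.
have gW := admissible_graphon adm CW.
have CWS := admissible_restriction adm mS S_gt0 CW.
have gWS := admissible_graphon adm CWS.
have a_gt0 : (0 < fine (gmu W S))%R.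
  by rewrite fine_gt0// S_gt0 ltey_eq fin_num_measure.
have b_le_density :
    (b <= fine (gmu W S) ^+ 2 * edge_density (restriction mS S_gt0))%R.
  rewrite -ler_pdivrMl ?exprn_gt0// -lee_fin (edge_density_restriction gW gWS).
  rewrite EFinM; apply: lee_wpmul2l => //.
  by rewrite lee_fin invr_ge0 exprn_ge0 ?ltW.
apply: (le_trans (lerXn2r (nedge H) _ _ b_le_density)).
- by rewrite nnegrE.
- by rewrite nnegrE (le_trans b0).
rewrite exprMn -exprM expfB_cond ?gt_eqF// -mulrA.
apply: ler_wpM2l; first by apply: exprn_ge0; exact: ltW.
exact: le_trans (sid _ CWS) (hom_density_restriction_le gW gWS H).
Qed.

(** * Regularity in the case of equality *)

Lemma edge_density0_regular (R : realType) (W : pregraphon R) :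
  is_graphon W -> edge_density W = 0%R -> regular W 0%R.
Proof.
move=> gW p0.
have /ae_eq_integral_abs : \int[gmu W]_x `|(@degree R W x)%:E| = 0.
  rewrite -[RHS]/(0%R%:E) -p0 -(integral_degree gW).
  by apply: eq_integral => x _; rewrite gee0_abs// lee_fin degree_ge0.
move=> /(_ measurableT) D.
have {}D := D ((measurable_EFinP _ _).2 (measurable_degree gW)).
by apply: filterS D => x /(_ I) /= [] ->.
Qed.

Local Close Scope ereal_scope.

Theorem theorem1p1 (R : realType) (C : pregraphon R -> Prop) (H : sgraph)
    (W : pregraphon R) :
  admissible C ->
  (nvert H < 2 * nedge H)%N ->
  sidorenko C H ->
  C W ->
  hom_density H W = edge_density W ^+ nedge H ->
  regular W (edge_density W).
Proof.
move=> adm vn sid CW homE.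
have gW := admissible_graphon adm CW.
have deg0 := degree_ge0 gW.
have degI := integral_degree gW.
have [W0|] := eqVneq (edge_density W) 0.
  by rewrite W0; exact: edge_density0_regular.
set p := edge_density W in homE degI * => pn0.
have p_gt0 : 0 < p.
  rewrite lt_neqAle eq_sym pn0 -lee_fin -degI.
  by apply: integral_ge0 => x _; rewrite lee_fin.
apply: contrapT => nreg.
(* At least half of the edge mass will be inside [S], so the Sidorenko
   inequality forces the measure of [S] to be at least 2^-(nedge H); the error
   bound [e] is half of that. *)
pose e : R := 2^-1 ^+ (nedge H).+1.
have e_gt0 : 0 < e by rewrite exprn_gt0// invr_gt0.
(* 2 * nedge H > nvert H forces an edge, so that [e] is at most 1/4: this makes
   the edge mass outside [S] at most half of the total. *)
have e_le : e <= 2^-1 ^+ 2.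
  apply: ler_wiXn2l; [by rewrite invr_ge0|by rewrite invf_le1 ?ler1n|].
  by rewrite ltnS; case: (nedge H) vn.
have e_le1 : e <= 1.
  by rewrite exprn_ile1 ?invr_ge0// invf_le1 ?ler1n.
have e01 : 0 < e <= 1 by rewrite e_gt0.
have [k [S [k0 mS Se outside]]] :=
  exists_separating_set (measurable_degree gW) deg0 p_gt0 degI nreg e01.
have CWk := admissible_tensor adm CW k0.
have gWk := admissible_graphon adm CWk.
set Wk := tensor_power W k in CWk gWk.
pose m := (\int[gmu Wk]_(x in S) \int[gmu Wk]_(y in S) (gfun Wk (x, y))%:E)%E.
have m_ge : ((p ^+ k * 2^-1)%:E <= m)%E.
  have := integral_square_lower_bound (gmu Wk) (measurable_gfun gWk)
    (gfun_ge0 gWk) (gfunC gWk) mS.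
  rewrite -(edge_densityE gWk) (edge_density_tensor_power gW gWk) -/p -/m.
  under eq_integral do rewrite -(degreeE gWk) (degree_tensor_power gW gWk).
  move=> /le_trans /(_ (leeD2l _ (leeD outside outside))).
  case: (m) => [x| |]; [|by move=> _; exact: leey|by rewrite -EFinD leeNy_eq].
  rewrite -!EFinD !lee_fin => le_pk.
  have pk_e : p ^+ k * e <= p ^+ k * 2^-1 ^+ 2.
    by apply: ler_wpM2l => //; apply: exprn_ge0; exact: ltW.
  clear - le_pk pk_e; lra.
have half_gt0 : 0 < p ^+ k * 2^-1 by rewrite mulr_gt0 ?exprn_gt0// invr_gt0.
have S_gt0 : (0 < gmu Wk S)%E.
  rewrite lt0e measure_ge0 andbT; apply/eqP => S0.
  have m0 : m = 0%E.
    apply: null_set_integral => //; apply: measurable_funTS.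
    exact: (measurable_integral_section _ (measurable_gfun gWk)
      (gfun_ge0 gWk) mS).
  by move: m_ge; rewrite m0 lee_fin leNgt half_gt0.
have := sidorenko_restriction adm sid CWk mS S_gt0 (ltnW vn) (ltW half_gt0)
  m_ge.
rewrite (hom_density_tensor_power gW gWk) homE exprMn -!exprM mulnC.
rewrite mulrC ler_pM2r ?exprn_gt0// leNgt => /negP; apply.
have a_le : fine (gmu Wk S) <= e.
  by rewrite -lee_fin fineK// fin_num_measure.
apply: (@le_lt_trans _ _ e).
  apply: (le_trans _ a_le); rewrite -[leRHS]expr1; apply: ler_wiXn2l.
  - by rewrite fine_ge0.
  - exact: le_trans a_le e_le1.
  - by rewrite subn_gt0.
by rewrite /e exprS gtr_pMl ?exprn_gt0 ?invr_gt0// invf_lt1 ?ltr1n.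
Qed.
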